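(* Let $M$ be a strong lattice path matroid $M=M[p,q]$ on $E=\{1,\ldots,n\}$ with $\operatorname{rk}_M(E)\ge2$ that has neither loops nor pairs of parallel elements. Then either the Western coline of $M$ is quite simple, or the element $n$ is a coloop of $M$; and in the latter case either $M$ has another coloop or $\operatorname{rk}_M(E)\ge 3$.
   Context: A lattice path of length $n$ is a tuple $(r_i)_{i=1}^n\in\{\mathrm{N},\mathrm{E}\}^n$. For lattice paths $p,q$ of length $n$, we write $p\preceq q$ if for all $k$, $|\{i\le k\mid p_i=\mathrm{N}\}|\le|\{i\le k\mid q_i=\mathrm{N}\}|$, with equality for $k=n$. $\mathrm{P}[p,q]=\{r\mid p\preceq r\preceq q\}$. For $p\preceq q$, the strong lattice path matroid $M[p,q]$ is the transversal matroid on $\{1,\ldots,n\}$ presented by the family $(A_i)_{i=1}^m$, $m=|\{i\mid q_i=\mathrm{N}\}|$, where $A_i$ is the set of $j$ such that some $r\in\mathrm{P}[p,q]$ has $r_j=\mathrm{N}$ and $|\{k\le j\mid r_k=\mathrm{N}\}|=i$. A strong lattice path matroid is a matroid of the form $M[p,q]$ with $p\preceq q$. With $N_q=\{i\mid q_i=\mathrm{N}\}$, $j_1=\max N_q$, $j_2=\max(N_q\setminus\{j_1\})$, the Western coline of $M[p,q]$ is $\{1,\ldots,j_2-1\}$. A coline of $M$ is a flat $X$ with $\operatorname{rk}_M(X)=\operatorname{rk}_M(E)-2$; a copoint on $X$ is a flat $Y\supseteq X$ with $\operatorname{rk}_M(Y)=\operatorname{rk}_M(E)-1$, simple if $|Y\setminus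 X|=1$, multiple if $|Y\setminus X|>1$. A coline is quite simple if there are more simple copoints on it than multiple copoints on it. *)

(* Defs.v *)
From HB Require Import structures.
From mathcomp Require Import all_boot.

Set Implicit Arguments.
Unset Strict Implicit.
Unset Printing Implicit Defensive.

(** * Matroids on a finite ground type (the ground set is the whole type) *)

Record matroid (T : finType) := Matroid {
  indep : {set {set T}};
  indep0 : set0 \in indep;
  indepS : forall X Y : {set T}, Y \in indep -> X \subset Y -> X \in indep;
  indep_aug : forall X Y : {set T}, X \in indep -> Y \in indep ->
    #|X| < #|Y| -> exists2 y, y \in Y :\: X & y |: X \in indep
}.

Section MatroidNotions.

Variables (T : finType) (M : matroid T).
Implicit Types (X Y B : {set T}) (e f : T).

Definition rk X : nat := \max_(I in indep M | I \subset X) #|I|.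

Definition basis B : bool := maxset (fun I => I \in indep M) B.

Definition loop e : bool := [set e] \notin indep M.

Definition parallel e f : bool :=
  [&& e != f, ~~ loop e, ~~ loop f & [set e; f] \notin indep M].

Definition coloop e : bool := [forall B, basis B ==> (e \in B)].

Definition flat X : bool :=
  [forall e, (e \notin X) ==> (rk X < rk (e |: X))].

(* The codimension is written additively because subtraction on nat is
   truncated. *)
Definition coline X : bool := flat X && (rk X + 2 == rk setT).

Definition copoint_on X Y : bool :=
  [&& flat Y, X \subset Y & rk Y + 1 == rk setT].

Definition simple_copoints X : {set {set T}} :=
  [set Y | copoint_on X Y & #|Y :\: X| == 1].

Definition multiple_copoints X : {set {set T}} :=
  [set Y | copoint_on X Y & 1 < #|Y :\: X|].

Definition quite_simple_coline X : bool :=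
  coline X && (#|multiple_copoints X| < #|simple_copoints X|).

End MatroidNotions.

(** * Transversal matroids *)

Section Transversal.

Variables (T I : finType) (A : I -> {set T}).

(* The codomain is [option I], rather than [I], so that the empty set has a
   matching even when the family is empty; only values on [X] matter, and
   these must be proper indices. *)
Definition matches (f : {ffun T -> option I}) (X : {set T}) : bool :=
  [forall x in X, if f x is Some i then x \in A i else false]
  && [forall x in X, forall y in X, (f x == f y) ==> (x == y)].

Definition partial_transversals : {set {set T}} :=
  [set X | [exists f, matches f X]].

Lemma matchesP (f : {ffun T -> option I}) (X : {set T}) :
  reflect ((forall x, x \in X -> exists2 i, f x = Some i & x \in A i)
           /\ {in X &, injective f})
          (matches f X).
Proof.
apply: (iffP andP) => [[/forall_inP fA /forall_inP fI]|[fA fI]]; split.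
- by move=> x /fA; case: (f x) => // i xi; exists i.
- by move=> x y /fI/forall_inP fIx /fIx/implyP fxy /eqP/fxy/eqP.
- by apply/forall_inP => x /fA[i -> ->].
- apply/forall_inP => x xX; apply/forall_inP => y yX.
  by apply/implyP => /eqP /fI ->.
Qed.

Lemma partial_transversals0 : set0 \in partial_transversals.
Proof.
rewrite inE; apply/existsP; exists [ffun=> None].
by apply/matchesP; split=> [x|x y]; rewrite inE.
Qed.

Lemma partial_transversalsS (X Y : {set T}) :
  Y \in partial_transversals -> X \subset Y -> X \in partial_transversals.
Proof.
rewrite !inE => /existsP[f /matchesP[fA fI]] /subsetP sXY.
apply/existsP; exists f; apply/matchesP; split=> [x /sXY /fA //|x y xX yX].
by apply: fI; apply: sXY.
Qed.

Lemma partial_transversals_aug (X Y : {set T}) :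
  X \in partial_transversals -> Y \in partial_transversals ->
  #|X| < #|Y| -> exists2 y, y \in Y :\: X & y |: X \in partial_transversals.
Proof.
rewrite !inE => /existsP[f0 f0X] /existsP[g /matchesP[gA gI]] ltXY.
pose agree (f : {ffun T -> option I}) := #|[set x in X | f x == g x]|.
have [f /matchesP[fA fI] fmax] :=
  @arg_maxnP _ f0 (fun f => matches f X) agree f0X.
have [y yY gyX] : exists2 y, y \in Y & g y \notin f @: X.
  apply/exists_inP; apply: contraLR ltXY; rewrite negb_exists_in.
  move=> /forall_inP h; rewrite -leqNgt.
  have /subset_leq_card : g @: Y \subset f @: X.
    by apply/subsetP => _ /imsetP[y yY ->]; move/negbNE: (h y yY).
  by rewrite !card_in_imset.
pose f' := [ffun x => if x == y then g y else f x].
have f'X : matches f' (y |: X).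
  apply/matchesP; split=> [x|x z].
    rewrite !inE ffunE; have [-> _|_ /= /fA //] := eqVneq x y; exact: gA.
  rewrite !inE !ffunE.
  have [->|_ /=] := eqVneq x y; have [->|_ /=] := eqVneq z y => //.
  - by move=> _ zX gfz; rewrite gfz imset_f in gyX.
  - by move=> xX _ fgx; rewrite -fgx imset_f in gyX.
  - exact: fI.
have [yX|yX] := boolP (y \in X); last first.
  by exists y; [rewrite !inE yX | rewrite inE; apply/existsP; exists f'].
rewrite (setUidPr _) ?sub1set // in f'X.
have: agree f' <= agree f := fmax _ f'X; rewrite leqNgt => /negP[].
apply/proper_card/properP; split.
  apply/subsetP => x; rewrite !inE ffunE => /andP[-> /eqP fx].
  by have [->|_] := eqVneq x y; rewrite ?fx eqxx.
exists y; rewrite !inE yX ?ffunE ?eqxx //=.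
by apply: contra gyX => /eqP <-; rewrite imset_f.
Qed.

Definition transversal_matroid : matroid T :=
  Matroid partial_transversals0 partial_transversalsS
          partial_transversals_aug.

End Transversal.

(** * Lattice paths *)

Inductive step := North | East.

Definition is_north (s : step) : bool := if s is North then true else false.
Definition step_of_bool (b : bool) : step := if b then North else East.
Lemma is_northK : cancel is_north step_of_bool. Proof. by case. Qed.
HB.instance Definition _ := Finite.copy step (can_type is_northK).

(* Position [i : 'I_n] stands for the (i+1)-st step of a path, and, as an
   element of the matroid, for the element i+1 of {1, ..., n}. *)
Definition lattice_path (n : nat) := n.-tuple step.

Section LatticePaths.

Variable n : nat.
Implicit Types (p q r : lattice_path n) (k : nat).

Definition north_set r : {set 'I_n} := [set i | tnth r i == North].

(* The number of North steps among the first k steps. *)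
Definition norths r k : nat := #|[set i in north_set r | i < k]|.

Definition lpath_le p q : bool :=
  [forall k : 'I_n.+1, norths p k <= norths q k] && (norths p n == norths q n).

Definition paths_between p q : {set lattice_path n} :=
  [set r | lpath_le p r & lpath_le r q].

(* The index [i : 'I_m] stands for i+1 in {1, ..., m}. *)
Definition lpm_family p q (i : 'I_#|north_set q|) : {set 'I_n} :=
  [set j : 'I_n | [exists r in paths_between p q,
    (tnth r j == North) && (norths r j.+1 == i.+1)]].

Definition lattice_path_matroid p q : matroid 'I_n :=
  transversal_matroid (lpm_family p (q := q)).

(* [west_j1] and [west_j2] are elements of {1, ..., n}, hence the successors;
   they default to 0 when the maximum is over the empty set. *)
Definition west_j1 q : nat := \max_(i in north_set q) i.+1.

Definition west_j2 q : nat :=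
  \max_(i in north_set q | i.+1 != west_j1 q) i.+1.

Definition western_coline q : {set 'I_n} := [set i : 'I_n | i.+1 < west_j2 q].

End LatticePaths.

(* Main.v *)
Require Import Defs.
From mathcomp Require Import all_boot.
From mathcomp Require Import zify.

(** An element [x] lies in the [i]-th set of the family exactly when
    [norths p x <= i < norths q x.+1], so independence means having an
    injective choice of such heights [i].  Let [a < b] be the positions of the
    last two North steps of [q] and [m] the rank.  Without loops and parallel
    elements, the last element [en] is the only one meeting just the last set.
    If [b = en], only [en] meets the last set, so it is a coloop.  Otherwise
    the Western coline [X], which consists of the elements below [a], together
    with [y < z], [a <= y], [b <= z] spans the matroid: hence adding [b] or [en]
    to [X] yields two simple copoints, while the elements below [b] form the
    only possible multiple copoint. *)

Set Implicit Arguments.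
Unset Strict Implicit.
Unset Printing Implicit Defensive.

(** * Rank, bases and coloops of a matroid *)

Section MatroidRank.

Variables (T : finType) (M : matroid T).
Implicit Types (X Y I B : {set T}) (e f : T).

Lemma indep_rk I X : I \in indep M -> I \subset X -> #|I| <= rk M X.
Proof.
move=> II sIX; apply: (@leq_bigmax_cond _ _ (fun J : {set T} => #|J|)).
by rewrite II.
Qed.

Lemma rk_leq X k :
  (forall I, I \in indep M -> I \subset X -> #|I| <= k) -> rk M X <= k.
Proof. by move=> h; apply/bigmax_leqP => I /andP[]; apply: h. Qed.

Lemma rk_setU1 e X : rk M (e |: X) <= (rk M X).+1.
Proof.
apply: rk_leq => I II sI.
have := @indep_rk (I :\ e) X (indepS II (subD1set _ _)).
rewrite subDset => /(_ sI).
by have := cardsD1 e I; case: (e \in I) => /= -> //; lia.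
Qed.

Lemma basis_indep B : basis M B -> B \in indep M.
Proof. by case/maxsetP. Qed.

Lemma card_basis B : basis M B -> #|B| = rk M setT.
Proof.
case/maxsetP => BI Bmax; apply/eqP; rewrite eqn_leq indep_rk ?subsetT //=.
apply: rk_leq => I II _; rewrite leqNgt; apply/negP => ltBI.
have [y] := indep_aug BI II ltBI; rewrite inE => /andP[yB _] yBI.
by have eB := Bmax _ yBI (subsetUr _ _); rewrite -eB setU11 in yB.
Qed.

Lemma basis_of_card I : I \in indep M -> rk M setT <= #|I| -> basis M I.
Proof.
move=> II leI; apply/maxsetP; split=> // J JI sIJ; apply/esym/eqP.
by rewrite eqEcard sIJ (leq_trans (indep_rk JI (subsetT _))).
Qed.

(* With a coloop [e] in rank 2, a pair of elements avoiding [e] would be a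
   basis or a parallel pair. *)
Lemma rk2_coloop e :
  rk M setT = 2 -> (forall f, ~~ loop M f) -> (forall f g, ~~ parallel M f g) ->
  coloop M e -> exists2 f, f != e & coloop M f.
Proof.
move=> rk2 nl np ce.
have pair_dep f g : f != e -> g != e -> f = g.
  move=> fe ge; apply/eqP/negPn/negP => fg.
  have fgI : [set f; g] \in indep M.
    by have := np f g; rewrite /parallel fg !nl /= negbK.
  have Bfg : basis M [set f; g] by apply: basis_of_card; rewrite // rk2 cards2 fg.
  have := forallP ce [set f; g]; rewrite Bfg !inE /= => /orP[] /eqP E.
    by rewrite E eqxx in fe.
  by rewrite E eqxx in ge.
have other B : basis M B -> exists2 f, f \in B & f != e.
  move=> BB; have cB := card_basis BB.
  have : 0 < #|B :\ e| by have := cardsD1 e B; case: (e \in B) => /=; lia.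
  by case/card_gt0P => f; rewrite !inE => /andP[fe fB]; exists f.
have [B BB _] := @maxset_exists _ (fun I => I \in indep M) set0 (indep0 M).
have [f fB fe] := other B BB; exists f => //.
apply/forallP => B'; apply/implyP => /other[g gB' ge].
by rewrite (pair_dep f g).
Qed.

End MatroidRank.

(** * Heights of lattice paths *)

Section Norths.

Variable n : nat.
Implicit Types (r : lattice_path n).

Lemma norths0 r : norths r 0 = 0.
Proof.
by apply/eqP; rewrite cards_eq0; apply/eqP/setP => i; rewrite !inE ltn0 andbF.
Qed.

Lemma northsS r (j : 'I_n) : norths r j.+1 = norths r j + (tnth r j == North).
Proof.
rewrite /norths (cardsD1 j) !inE ltnS leqnn andbT addnC; congr (_ + _).
apply: eq_card => i; rewrite !inE ltnS (ltn_neqAle i j).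
by case: (tnth r i == North); rewrite ?andbF.
Qed.

Lemma norths_homo r : {homo norths r : k l / k <= l}.
Proof.
move=> k l kl; apply/subset_leq_card/subsetP => i; rewrite !inE => /andP[-> ik].
exact: leq_trans kl.
Qed.

Lemma norths_full r : norths r n = #|north_set r|.
Proof. by apply: eq_card => i; rewrite !inE ltn_ord andbT. Qed.

(** Reduces the construction of a path to that of its height function: the path goes North exactly
    where [h] increases. *)
Lemma norths_path (h : nat -> nat) :
  h 0 = 0 -> (forall k, k < n -> h k <= h k.+1 <= (h k).+1) ->
  exists r, forall k, k <= n -> norths r k = h k.
Proof.
move=> h0 hS; pose r := [tuple step_of_bool (h i < h i.+1) | i < n].
exists r; elim=> [|k IH] kn; first by rewrite norths0 h0.
rewrite (northsS r (Ordinal kn)) /= IH ?(ltnW kn) // tnth_mktuple /=.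
by have := hS k kn; case: ltnP => /=; lia.
Qed.

End Norths.

(** * Independence and rank in lattice path matroids *)

Section LatticePathMatroid.

Variables (n : nat) (p q : lattice_path n).
Hypothesis le_pq : lpath_le p q.

Lemma lpath_leP (r s : lattice_path n) :
  reflect ((forall k, k <= n -> norths r k <= norths s k)
           /\ norths r n = norths s n) (lpath_le r s).
Proof.
apply: (iffP andP) => [[/forallP h /eqP ->]|[h ->]]; split=> //.
  by move=> k; rewrite -ltnS => kn; apply: (h (Ordinal kn)).
by apply/forallP => k; apply: h; rewrite -ltnS.
Qed.

Lemma mem_lpm_family (i : 'I_#|north_set q|) (j : 'I_n) :
  (j \in lpm_family p i) = (norths p j <= i < norths q j.+1).
Proof.
have [lepq eqpq] := lpath_leP _ _ le_pq.
rewrite inE; apply/exists_inP/idP => [[r]|/andP[pi qi]].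
  rewrite inE => /andP[/lpath_leP[pr _] /lpath_leP[rq _]] /andP[rN /eqP rS].
  have := northsS r j; rewrite rN rS.
  by have := pr j (ltnW (ltn_ord j)); have := rq j.+1 (ltn_ord j); lia.
(* Clamp the path at height [i] up to [j] and at height [i + 1] afterwards
   between [p] and [q]. *)
pose h k := maxn (norths p k) (minn (norths q k) (i + (j < k))).
have [|k kn|r rh] := @norths_path n h; first by rewrite /h !norths0 min0n.
  (* Each of the three clamped heights rises by 0 or 1 per step, and maxima and minima preserve
     this. *)
  have [pS qS] := (northsS p (Ordinal kn), northsS q (Ordinal kn)).
  have lek := lepq k (ltnW kn).
  rewrite /= in pS qS; move: pS qS; rewrite /h.
  case: (tnth p _ == North); case: (tnth q _ == North) => /= pS qS;
    have [jk|kj|jk] := ltngtP j k; rewrite /= ?ltnS; move: pi qi; rewrite ?jk; lia.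
have jn := ltn_ord j.
have [pS qS] := (northsS p j, northsS q j).
(* The bounds on [i] put [i] and [i + 1] between the two paths at [j] and [j.+1], so the clamp is
   inactive there. *)
have rj : norths r j = i.
  by rewrite rh ?(ltnW jn) // /h ltnn; case: (tnth q j == North) qS; lia.
have rj1 : norths r j.+1 = i.+1 by rewrite rh // /h leqnn; lia.
exists r.
  rewrite inE; apply/andP; split; apply/lpath_leP; split=> [k kn|].
  - by rewrite rh // /h; lia.
  - by rewrite rh // /h; lia.
  - by rewrite rh // /h; have := lepq k kn; lia.
  - by rewrite rh // /h; lia.
rewrite rj1 eqxx andbT; have := northsS r j; rewrite rj rj1.
by case: (_ == _) => //=; lia.
Qed.

Local Notation M := (lattice_path_matroid p q).

(** Trades matchings with optional indices for plain numbers. The index bound comes for free, as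
    [norths q x.+1] is at most the size of the family. *)
Lemma lpm_indepP (S : {set 'I_n}) :
  reflect (exists2 g : 'I_n -> nat,
             forall x, x \in S -> norths p x <= g x < norths q x.+1
           & {in S &, injective g})
          (S \in indep M).
Proof.
rewrite inE; apply: (iffP existsP) => [[f /matchesP[fA fI]]|[g gA gI]].
  exists (fun x => oapp (@nat_of_ord _) 0 (f x)) => [x /fA[i -> /=]|x y xS yS].
    by rewrite mem_lpm_family.
  have [i fx _] := fA x xS; have [j fy _] := fA y yS.
  rewrite fx fy /= => /val_inj ij; apply: fI => //.
  by rewrite fx fy ij.
have gm x : x \in S -> g x < #|north_set q|.
  case/gA/andP=> _ /leq_trans; apply.
  by rewrite -norths_full norths_homo.
exists [ffun x => insub (g x)]; apply/matchesP; split=> [x xS|x y xS yS].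
  rewrite ffunE (insubT (fun k => k < _) (gm x xS)).
  by exists (Ordinal (gm x xS)); rewrite // mem_lpm_family //; apply: gA.
rewrite !ffunE (insubT (fun k => k < _) (gm x xS)).
by rewrite (insubT (fun k => k < _) (gm y yS)) => -[]; apply: gI.
Qed.

(** The heights of the elements of [S] are distinct numbers below [k]. *)
Lemma lpm_card_indep (S : {set 'I_n}) k :
  S \in indep M -> (forall x, x \in S -> norths q x.+1 <= k) -> #|S| <= k.
Proof.
case/lpm_indepP => g gA gI qk.
rewrite cardE -(size_map g) -[k in _ <= k](size_iota 0).
apply: uniq_leq_size => [|_ /mapP[x + ->]].
  by rewrite map_inj_in_uniq ?enum_uniq // => x y; rewrite !mem_enum; apply: gI.
by rewrite mem_enum => xS; rewrite mem_iota /=; have := gA x xS; have := qk x xS; lia.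
Qed.

Lemma lpm_rk_leq (X : {set 'I_n}) k :
  (forall x, x \in X -> norths q x.+1 <= k) -> rk M X <= k.
Proof.
move=> qk; apply: rk_leq => I II /subsetP sIX.
by apply: lpm_card_indep => // x /sIX; apply: qk.
Qed.

Lemma lpm_north_setP (x : 'I_n) :
  x \in north_set q -> norths p x <= norths q x < norths q x.+1.
Proof.
rewrite inE => xN; rewrite northsS xN addn1 leqnn andbT.
by have [h _] := lpath_leP _ _ le_pq; apply/h/ltnW.
Qed.

Lemma norths_north_inj : {in north_set q &, injective (fun i : 'I_n => norths q i)}.
Proof.
have lt (x y : 'I_n) : x \in north_set q -> x < y -> norths q x < norths q y.
  case/lpm_north_setP/andP => _ + xy; move/leq_trans; apply; exact: norths_homo.
move=> x y xN yN; have [xy|yx|/val_inj //] := ltngtP x y.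
  by have := lt x y xN xy; lia.
by have := lt y x yN yx; lia.
Qed.

(** Each North step of [q] takes the height at which [q] makes it, the largest one allowed. *)
Lemma north_set_indep : north_set q \in indep M.
Proof.
apply/lpm_indepP; exists (fun x => norths q x); first exact: lpm_north_setP.
exact: norths_north_inj.
Qed.

Lemma lpm_rk : rk M setT = norths q n.
Proof.
apply/eqP; rewrite eqn_leq {2}norths_full (indep_rk north_set_indep) ?subsetT //.
by rewrite andbT; apply: lpm_rk_leq => x _; rewrite norths_homo.
Qed.

End LatticePathMatroid.

(** * The last two North steps of [q] *)

Lemma western_coline_spec n (q : lattice_path n) : 2 <= norths q n ->
  exists a b : 'I_n,
    [/\ a < b, norths q a = norths q n - 2, norths q a.+1 = norths q n - 1,
        norths q b = norths q n - 1 & norths q b.+1 = norths q n]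
    /\ western_coline q = [set i : 'I_n | i < a].
Proof.
move=> m2; have cN := norths_full q.
have [|b bN jb] := @eq_bigmax_cond _ (mem (north_set q)) (fun i => i.+1).
  by rewrite -cN; lia.
have bmax i : i \in north_set q -> i <= b.
  by move=> iN; rewrite -ltnS -jb; apply: leq_bigmax_cond.
have cNb : #|north_set q :\ b| = norths q n - 1.
  by have := cardsD1 b (north_set q); rewrite (_ : b \in _ = true) //; lia.
have memNb i : (i \in north_set q) && (i.+1 != b.+1) = (i \in north_set q :\ b).
  by rewrite !inE eqSS andbC.
have [|a aNb ja] := @eq_bigmax_cond _ (mem (north_set q :\ b)) (fun i => i.+1).
  by rewrite cNb; lia.
have amax i : i \in north_set q :\ b -> i <= a.
  by move=> iN; rewrite -ltnS -ja; apply: leq_bigmax_cond.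
have [ab aN] : a != b /\ a \in north_set q by exact/setD1P.
have ltab : a < b by rewrite ltn_neqAle ab bmax.
have qb1 : norths q b.+1 = norths q n.
  rewrite cN; apply: eq_card => i; rewrite inE ltnS.
  by case iN: (i \in _) => //=; rewrite bmax.
have qa1 : norths q a.+1 = norths q n - 1.
  rewrite -cNb; apply: eq_card => i; rewrite [in LHS]inE ltnS.
  apply/andP/idP => [[iN ia]|iNb]; last by rewrite amax //; move: iNb => /setD1P[].
  by rewrite in_setD1 iN andbT; apply: contraTneq ltab => <-; rewrite -leqNgt.
exists a, b; split; last first.
  (* Here [west_j1 q] is [b.+1] and [west_j2 q] is [a.+1], so the successors on both sides of the
     defining inequality cancel. *)
  apply/setP => i; rewrite !inE /west_j2 /west_j1 jb.
  by under eq_bigl => k do rewrite memNb; rewrite ja ltnS.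
move: aN bN; rewrite !inE => aN bN.
have := northsS q a; have := northsS q b; rewrite aN bN qa1 qb1.
by split=> //; lia.
Qed.

(** * Spanning sets over the Western coline *)

Section WesternColine.

Variables (n : nat) (p q : lattice_path n) (en : 'I_n).
Hypothesis le_pq : lpath_le p q.
Local Notation M := (lattice_path_matroid p q).
Local Notation m := (norths q n).
Hypothesis m_ge2 : 2 <= m.
Hypothesis last_en : en.+1 = n.
Hypothesis no_loop : forall e, ~~ loop M e.
Hypothesis no_parallel : forall e f, ~~ parallel M e f.

(** As [e] is not a loop, it has a height, which is at least [norths p e] and below
    [norths q e.+1 <= m]. *)
Lemma norths_lower_lt (e : 'I_n) : norths p e < m.
Proof.
have := no_loop e; rewrite negbK => /(lpm_indepP le_pq)[g + _].
by move/(_ e (set11 _)); have := @norths_homo _ q _ _ (ltn_ord e); lia.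
Qed.

(** Both paths end at height [m], and the last step of [p] climbs by at most 1; it must climb by
    [norths_lower_lt]. *)
Lemma norths_lower_last : norths p en = m - 1.
Proof.
have [_ eqpq] := lpath_leP _ _ le_pq.
have := northsS p en; rewrite last_en eqpq.
by have := norths_lower_lt en; case: (_ == _) => /=; lia.
Qed.

(** Otherwise [e] and [en] would both admit only the height [m - 1] and so be parallel. *)
Lemma norths_lower_notlast (e : 'I_n) : e != en -> norths p e <= m - 2.
Proof.
move=> een; rewrite leqNgt; apply/negP => lt_e.
have := no_parallel e en; rewrite /parallel een !no_loop /= negbK.
case/(lpm_indepP le_pq) => g gA gI; move/eqP: een; apply.
have e2 : e \in [set e; en] by rewrite !inE eqxx.
have en2 : en \in [set e; en] by rewrite !inE eqxx orbT.
apply: gI => //; have := gA e e2; have := gA en en2; rewrite norths_lower_last.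
have := @norths_homo _ q _ _ (ltn_ord e); have := @norths_homo _ q _ _ (ltn_ord en).
by lia.
Qed.

Variables a b : 'I_n.
Hypothesis lt_ab : a < b.
Hypothesis norths_a : norths q a = m - 2.
Hypothesis norths_aS : norths q a.+1 = m - 1.
Hypothesis norths_b : norths q b = m - 1.
Hypothesis norths_bS : norths q b.+1 = m.

Let X : {set 'I_n} := [set i : 'I_n | i < a].

(** A basis avoiding [en] would lie below [b], where only heights less than [m - 1] occur, and so
    would be too small. *)
Lemma last_coloop : b = en -> coloop M en.
Proof.
move=> b_en; apply/forallP => B; apply/implyP => BB; apply/negPn/negP => enB.
have : #|B| <= m - 1.
  apply: (lpm_card_indep le_pq (basis_indep BB)) => x xB.
  rewrite -norths_b norths_homo // b_en ltn_neqAle -ltnS last_en ltn_ord andbT.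
  by apply: contraNneq enB => /val_inj <-.
by rewrite (card_basis BB) lpm_rk //; lia.
Qed.

(** The North steps of [q] before [a] use heights below [m - 2], which leaves [m - 2] for [y] and
    [m - 1] for [z]. The upper bounds hold by [a <= y] and [b <= z], the lower ones by the absence
    of loops and parallel elements. *)
Lemma coline_pair_indep (y z : 'I_n) : a <= y -> y < z -> b <= z ->
  y |: (z |: (north_set q :&: X)) \in indep M.
Proof.
move=> ay yz bz.
(* For [en] the height [m - 2] would be too low. *)
have yen : y != en.
  by apply: contraTneq yz => ->; rewrite -leqNgt -ltnS last_en.
have zy : (z == y) = false by apply: contraTF yz => /eqP ->; rewrite ltnn.
pose g (x : 'I_n) := if x < a then norths q x else if x == y then m - 2 else m - 1.
have gX x : x \in north_set q :&: X -> g x = norths q x /\ g x < m - 2.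
  case/setIP => xN; rewrite inE => xa; rewrite /g xa.
  split=> //; rewrite -norths_a; case/andP: (lpm_north_setP le_pq xN) => _ lt.
  by apply: leq_trans lt _; apply: norths_homo.
have gy : g y = m - 2 by rewrite /g ltnNge ay eqxx.
have gz : g z = m - 1.
  by rewrite /g zy ltnNge (leq_trans (ltnW lt_ab) bz).
have qa x : a <= x -> m - 1 <= norths q x.+1.
  by move=> ax; rewrite -norths_aS norths_homo.
apply/lpm_indepP => //; exists g => [x|x x'].
  case/setU1P => [->|/setU1P[->|xX]].
  - by rewrite gy norths_lower_notlast //=; have := qa y ay; lia.
  - rewrite gz; have := norths_lower_lt z.
    by have := @norths_homo _ q _ _ (bz : b.+1 <= z.+1); lia.
  - have [-> _] := gX x xX; apply: lpm_north_setP => //.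
    by case/setIP: xX.
case/setU1P => [->|/setU1P[->|xX]]; case/setU1P => [->|/setU1P[->|x'X]] //;
  rewrite ?gy ?gz; try lia.
- by have [_ ?] := gX _ x'X; lia.
- by have [_ ?] := gX _ x'X; lia.
- by have [_ ?] := gX _ xX; lia.
- by have [_ ?] := gX _ xX; lia.
- have [-> _] := gX _ xX; have [-> _] := gX _ x'X.
  case/setIP: xX => xN _; case/setIP: x'X => x'N _.
  exact: (norths_north_inj le_pq xN x'N).
Qed.

Lemma card_coline_north : #|north_set q :&: X| = m - 2.
Proof.
by rewrite -norths_a; apply: eq_card => i; rewrite !inE.
Qed.

Lemma coline_pair_rk (Y : {set 'I_n}) (y z : 'I_n) :
  X \subset Y -> y \in Y -> z \in Y -> a <= y -> y < z -> b <= z ->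
  m <= rk M Y.
Proof.
move=> sXY yY zY ay yz bz.
have sub : y |: (z |: (north_set q :&: X)) \subset Y.
  rewrite !subUset !sub1set yY zY /=; apply: subset_trans sXY; exact: subsetIr.
apply: leq_trans (indep_rk (coline_pair_indep ay yz bz) sub).
have za : z < a = false by rewrite ltnNge (leq_trans ay (ltnW yz)).
have ya : y < a = false by rewrite ltnNge ay.
have yz' : (y == z) = false by apply: contraTF yz => /eqP ->; rewrite ltnn.
rewrite !cardsU1 card_coline_north !inE ya za yz' !andbF /=; lia.
Qed.

Lemma rk_western : rk M X = m - 2.
Proof.
apply/eqP; rewrite eqn_leq; apply/andP; split.
  by apply: lpm_rk_leq => // x; rewrite inE -norths_a => xa; apply: norths_homo.
rewrite -card_coline_north; apply: indep_rk; last exact: subsetIr.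
by apply: indepS (subsetIl _ _); apply: north_set_indep.
Qed.

(** * Copoints on the Western coline when [q] ends with an East step *)

Hypothesis lt_b_en : b < en.

Lemma le_last (e : 'I_n) : e <= en.
Proof. by rewrite -ltnS last_en. Qed.

(* Any element outside the coline has a partner with which it spans: [en], or
   [a] in the case of [en] itself. *)
Lemma rk_western_setU1 (e : 'I_n) : a <= e -> rk M (e |: X) = m - 1.
Proof.
move=> ae; apply/eqP; rewrite eqn_leq; apply/andP; split.
  by apply: leq_trans (rk_setU1 M e X) _; rewrite rk_western; lia.
pose f := if e == en then a else en.
have : m <= rk M (f |: (e |: X)).
  have sX g : X \subset g |: (e |: X) by rewrite setUCA setUA subsetUr.
  rewrite /f; have [->|een] := eqVneq e en.
    by apply: (@coline_pair_rk _ a en); rewrite ?in_setU ?set11 ?orbT //;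
      [rewrite setUCA setUA subsetUr | apply: ltn_trans lt_b_en | apply: ltnW].
  apply: (@coline_pair_rk _ e en); rewrite ?in_setU ?set11 ?orbT //.
    by rewrite ltn_neqAle le_last andbT.
  exact: ltnW.
by move/leq_trans/(_ (rk_setU1 M f (e |: X))); rewrite leq_subLR add1n.
Qed.

Lemma coline_western : coline M X.
Proof.
rewrite /coline rk_western lpm_rk //; apply/andP; split; last by apply/eqP; lia.
apply/forallP => e; apply/implyP; rewrite inE -leqNgt => ae.
by rewrite rk_western rk_western_setU1 //; lia.
Qed.

(** For flatness, any further [f] outside the coline forms with [e] a pair whose larger member is at
    least [b], so [coline_pair_rk] applies. *)
Lemma simple_copoint_western (e : 'I_n) :
  b <= e -> e |: X \in simple_copoints M X.
Proof.
move=> be; have ae : a <= e := leq_trans (ltnW lt_ab) be.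
have eX : e \notin X by rewrite inE -leqNgt.
have De : (e |: X) :\: X = [set e].
  apply/setP => x; rewrite !inE; have [->|_ /=] := eqVneq x e.
    by rewrite -leqNgt ae.
  by rewrite andNb.
rewrite inE De cards1 eqxx andbT; apply/and3P; split; last 2 first.
- exact: subsetUr.
- by rewrite rk_western_setU1 // lpm_rk //; apply/eqP; lia.
apply/forallP => f; apply/implyP; rewrite !inE negb_or -leqNgt => /andP[fe af].
rewrite rk_western_setU1 //; apply: (@leq_trans m); first by lia.
have sX : X \subset f |: (e |: X) by rewrite setUCA setUA subsetUr.
have fin : f \in f |: (e |: X) by rewrite in_setU set11.
have ein : e \in f |: (e |: X) by rewrite !in_setU set11 orbT.
have [lt|gt|/val_inj E] := ltngtP f e.
- exact: (coline_pair_rk sX fin ein).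
- by apply: (coline_pair_rk sX ein fin) => //; apply: leq_trans (ltnW gt).
- by rewrite E eqxx in fe.
Qed.

(** An element of [Y] from [b] on would span together with a second element of [Y] outside the
    coline. So [Y] lies below [b], and flatness forces equality because all elements below [b]
    together have rank at most [m - 1]. *)
Lemma multiple_copoint_western (Y : {set 'I_n}) :
  Y \in multiple_copoints M X -> Y = [set i : 'I_n | i < b].
Proof.
rewrite inE => /andP[/and3P[/forallP flatY sXY /eqP]].
rewrite lpm_rk // => rkY /card_gt1P[y [z [+ + yz]]].
rewrite !in_setD !inE -!leqNgt => /andP[ay yY] /andP[az zY].
have small x : x \in Y -> x < b.
  move=> xY; rewrite ltnNge; apply/negP => bx.
  (* At least one of [y] and [z] differs from [x]. *)
  have [w [wY aw wx]] : exists w, [/\ w \in Y, a <= w & w != x].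
    have [E|ne] := eqVneq y x; last by exists y.
    by exists z; split=> //; rewrite -E eq_sym.
  have : m <= rk M Y; last by lia.
  have [lt|gt|/val_inj E] := ltngtP w x.
  - exact: (coline_pair_rk sXY wY xY).
  - apply: (coline_pair_rk sXY xY wY) => //; last by apply: leq_trans (ltnW gt).
    exact: leq_trans (ltnW lt_ab) bx.
  - by rewrite E eqxx in wx.
apply/setP => x; rewrite inE; apply/idP/idP => [/small //|xb].
apply/negPn/negP => xY; have := flatY x; rewrite xY /=.
have : rk M (x |: Y) <= m - 1; last by lia.
apply: lpm_rk_leq => // w; rewrite -norths_b => /setU1P[->|/small wb];
  exact: norths_homo.
Qed.

Lemma quite_simple_western : quite_simple_coline M X.
Proof.
rewrite /quite_simple_coline coline_western /=.
apply: (@leq_ltn_trans 1).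
  rewrite -(cards1 [set i : 'I_n | i < b]).
  apply/subset_leq_card/subsetP => Y /multiple_copoint_western ->.
  exact: set11.
(* These two copoints differ at [b], which is neither [en] nor in the coline. *)
apply/card_gt1P; exists (b |: X), (en |: X); split.
- exact: simple_copoint_western.
- exact/simple_copoint_western/ltnW.
- apply/eqP => /setP/(_ b); rewrite !inE eqxx /=.
  by rewrite -val_eqE /= (ltn_eqF lt_b_en) ltnNge (ltnW lt_ab).
Qed.

End WesternColine.

Theorem mainTheorem4 (n : nat) (p q : lattice_path n) (M : matroid 'I_n)
    (le_pq : lpath_le p q)
    (defM : M = lattice_path_matroid p q)
    (rkM : 2 <= rk M [set: 'I_n])
    (no_loop : forall e : 'I_n, ~~ loop M e)
    (no_parallel : forall e f : 'I_n, ~~ parallel M e f)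
    (en : 'I_n) (last_en : en.+1 = n) :
  (quite_simple_coline M (western_coline q) \/ coloop M en) /\
  (coloop M en ->
     (exists2 e : 'I_n, e != en & coloop M e) \/ 3 <= rk M [set: 'I_n]).
Proof.
split; last first.
  (* Rank exactly 2 is the only case besides rank at least 3. *)
  move=> cen; move: rkM; rewrite leq_eqVlt => /orP[/eqP rk2|]; last by right.
  by left; apply: rk2_coloop.
subst M; have m2 : 2 <= norths q n by rewrite -(lpm_rk le_pq).
have [a [b [[ab qa qaS qb qbS] ->]]] := western_coline_spec m2.
have [b_en|b_en] := eqVneq b en.
  by right; apply: (@last_coloop _ p q en le_pq m2 last_en a b).
left; apply: (@quite_simple_western _ p q en _ _ _ _ _ a b) => //.
by rewrite ltn_neqAle b_en -ltnS last_en ltn_ord.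
Qed.
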